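(* Let $\mathcal{H}$ be a real Hilbert space, $A:\mathcal{H}\rightrightarrows\mathcal{H}$ a maximally monotone operator, $D:\mathcal{H}\to\mathcal{H}$ a monotone and $\eta^{-1}$-Lipschitz continuous operator with $\eta>0$, $B:\mathcal{H}\to\mathcal{H}$ a monotone and $\mu^{-1}$-Lipschitz continuous operator with $\mu>0$, and suppose $C=\operatorname{zer}B\neq\emptyset$. Let $(\lambda_n)_{n\ge1}$ and $(\beta_n)_{n\ge1}$ be sequences of positive real numbers, let $x_1\in\mathcal{H}$ and let $(x_n)_{n\ge1}$, $(p_n)_{n\ge1}$ be generated, for all $n\ge1$, by $$p_n=J_{\lambda_nA}(x_n-\lambda_nDx_n-\lambda_n\beta_nBx_n),\qquad x_{n+1}=\lambda_n\beta_n(Bx_n-Bp_n)+\lambda_n(Dx_n-Dp_n)+p_n .$$ Assume that: (1) $A+N_C$ is maximally monotone and $\operatorname{zer}(A+D+N_C)\neq\emptyset$; (2) for every $p\in\operatorname{ran}N_C$, $\ \sum_{n\ge1}\lambda_n\beta_n\left[\sup_{u\in C}\varphi_B\left(u,\frac{p}{\beta_n}\right)-\sigma_C\left(\frac{p}{\beta_n}\right)\right]<+\infty$; (3) $(\lambda_n)_{n\ge1}\in\ell^2\setminus\ell^1$; (4) $\limsup_{n\to+\infty}\left(\frac{\lambda_n\beta_n}{\mu}+\frac{\lambda_n}{\eta}\right)<1$; (5) $A$ is $\gamma$-strongly monotone with $\gamma>0$. Then $(x_n)_{n\ge1}$ converges strongly to the unique element of $\operatorname{zer}(A+D+N_C)$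 as $n\to+\infty$.
   Context: For a set-valued operator $M:\mathcal{H}\rightrightarrows\mathcal{H}$: $\operatorname{Gr}M=\{(x,u):u\in Mx\}$, $\operatorname{ran}M=\{u:\exists x,\ u\in Mx\}$, $\operatorname{zer}M=\{x:0\in Mx\}$, and $J_M=(\mathrm{Id}+M)^{-1}$ is the resolvent (single-valued and everywhere defined when $M$ is maximally monotone). $M$ is monotone if $\langle x-y,u-v\rangle\ge0$ for all $(x,u),(y,v)\in\operatorname{Gr}M$; maximally monotone if its graph has no proper monotone extension; $\gamma$-strongly monotone if $\langle x-y,u-v\rangle\ge\gamma\|x-y\|^2$ for all $(x,u),(y,v)\in\operatorname{Gr}M$. The normal cone of $C$ is $N_C(x)=\{u:\langle u,y-x\rangle\le0\ \forall y\in C\}$ if $x\in C$ and $N_C(x)=\emptyset$ otherwise; the support function is $\sigma_C(u)=\sup_{y\in C}\langle y,u\rangle$. The Fitzpatrick function of a monotone operator $M$ is $\varphi_M(x,u)=\sup_{(y,v)\in\operatorname{Gr}M}\{\langle x,v\rangle+\langle y,u\rangle-\langle y,v\rangle\}$, with values in the extended reals. *)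

(* Defs.v *)
From HB Require Import structures.
From mathcomp Require Export all_boot all_order all_algebra.
From mathcomp Require Export all_classical all_reals all_analysis.
Export Order.TTheory GRing.Theory Num.Theory.
Export numFieldNormedType.Exports.

Set Implicit Arguments.
Unset Strict Implicit.
Unset Printing Implicit Defensive.

Local Open Scope classical_set_scope.
Local Open Scope ring_scope.

(* A real Hilbert space is a [completeNormedModType R] together with a
   positive definite symmetric bilinear form [ip : {dot H for idfun}] that
   induces the norm: [inner_norm ip]. *)
Definition inner_norm (R : realType) (H : completeNormedModType R)
    (ip : {dot H for idfun}) : Prop :=
  forall x : H, ip x x = `|x| ^+ 2.

(* A set-valued operator on [H] is a function [H -> set H]. *)
Section SetValuedOperators.
Variables (R : realType) (H : completeNormedModType R).
Implicit Types (M N : H -> set H) (f : H -> H).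

Definition op_of_fun f : H -> set H := fun x => [set f x].

Definition op_graph M : set (H * H) := [set xu | M xu.1 xu.2].

Definition op_ran M : set H := [set u | exists x, M x u].

Definition op_zer M : set H := [set x | M x 0].

Definition op_add M N : H -> set H :=
  fun x => [set u + v | u in M x & v in N x].

Definition op_scale (a : R) M : H -> set H :=
  fun x => [set a *: u | u in M x].

Definition op_inv M : H -> set H := fun u => [set x | M x u].

(* Set-valued: [p = J_M y] is rendered as [resolvent M y p]. *)
Definition resolvent M : H -> set H := op_inv (op_add (op_of_fun id) M).

Variable ip : {dot H for idfun}.

Definition op_monotone M : Prop :=
  forall x u y v, op_graph M (x, u) -> op_graph M (y, v) ->
    0 <= ip (x - y) (u - v).

Definition op_maximally_monotone M : Prop :=
  op_monotone M /\
  forall N, op_monotone N -> op_graph M `<=` op_graph N ->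
    op_graph N = op_graph M.

Definition op_strongly_monotone (gamma : R) M : Prop :=
  forall x u y v, op_graph M (x, u) -> op_graph M (y, v) ->
    gamma * `|x - y| ^+ 2 <= ip (x - y) (u - v).

Definition normal_cone (C : set H) : H -> set H :=
  fun x => [set u | C x /\ forall y, C y -> ip u (y - x) <= 0].

Definition support_fun (C : set H) (u : H) : \bar R :=
  ereal_sup [set (ip y u)%:E | y in C].

Definition fitzpatrick M (x u : H) : \bar R :=
  ereal_sup [set (ip x yv.2 + ip yv.1 u - ip yv.1 yv.2)%:E
            | yv in op_graph M].

End SetValuedOperators.

(* Sequences indexed by n >= 1 are functions on [nat] whose value at 0 is
   disregarded. *)
Definition ell (R : realType) (p : nat) (u : nat -> R) : Prop :=
  (\sum_(1 <= n <oo) (`|u n| ^+ p)%:E < +oo)%E.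

(* Main.v *)
(** Let [z] be a zero of [A + D + N_C], say [v + D z + q = 0] with [v] in [A z]
    and [q] in [N_C z]. Strong monotonicity of [A] at [p_n] and [z], monotonicity
    of [D], and the value at [(z, q / beta_n)] of the Fitzpatrick function of [B]
    give, with [e_n] the summable terms of hypothesis (2) and [k < 1] an eventual
    bound of [lambda_n beta_n / mu + lambda_n / eta],
    [|x_(n+1) - z|^2 + 2 gamma lambda_n |p_n - z|^2 + (1 - k^2) |x_n - p_n|^2
       <= |x_n - z|^2 + 2 e_n].
    As [lambda_n <= eta] eventually and
    [|x_n - z|^2 <= 2 |p_n - z|^2 + 2 |x_n - p_n|^2], the two extra terms on the
    left dominate [c lambda_n |x_n - z|^2] for some [c > 0]. Then [|x_n - z|^2]
    converges because [e_n] is summable, and to [0] because [lambda_n] is not.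
    This holds for every zero [z], so uniqueness of limits makes [z] unique. *)
Require Import Defs.
From mathcomp Require Import ring lra.

Set Implicit Arguments.
Unset Strict Implicit.
Unset Printing Implicit Defensive.

Local Open Scope classical_set_scope.
Local Open Scope ring_scope.

(** * Real sequences and series *)

(** Subtracting the partial sums of [e] from [a] leaves a nonincreasing sequence bounded below, so
    [a] converges; a positive limit would bound the partial sums of [l]. *)
Lemma series_decay_cvg0 (R : realType) (a e l : R^nat) :
  (forall n, 0 <= a n) -> (forall n, 0 <= e n) -> (forall n, 0 <= l n) ->
  (forall n, a n.+1 + l n * a n <= a n + e n) ->
  has_ubound (range (series e)) -> ~ has_ubound (range (series l)) ->
  a @ \oo --> 0.
Proof.
move=> a_ge0 e_ge0 l_ge0 rec [E Eub] l_div.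
have seriesS (u : R^nat) n : series u n.+1 = series u n + u n.
  by rewrite /series /= big_nat_recr.
have e_cvg : cvgn (series e).
  apply: nondecreasing_is_cvgn; last by exists E.
  by apply/nondecreasing_seqP => n; rewrite seriesS lerDl.
have ae_cvg : cvgn (fun n => a n - series e n).
  apply: nonincreasing_is_cvgn.
    apply/nonincreasing_seqP => n; rewrite seriesS.
    have := rec n; have := mulr_ge0 (l_ge0 n) (a_ge0 n); lra.
  exists (- E) => _ [n _ <-].
  have : series e n <= E by apply: Eub; exists n.
  have := a_ge0 n; lra.
have a_cvg : cvgn a.
  rewrite (_ : a = fun n => (a n - series e n) + series e n); first exact: is_cvgD.
  by apply/funext => n; rewrite subrK.
have L_ge0 : 0 <= limn a by apply: limr_ge => //; exact: nearW.
have [L0|L_neq0] := eqVneq (limn a) 0; first by rewrite -L0.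
have L_gt0 : 0 < limn a by rewrite lt_def L_neq0.
have [m _ am] : \forall n \near \oo, limn a / 2 < a n.
  by apply: (cvgr_gt (limn a)) => //; lra.
(* The recursion telescoped from [m] on, each [a] multiplying an [l] being replaced by its lower
   bound [limn a / 2]. *)
have tail n : a (m + n)%N + limn a / 2 * (series l (m + n)%N - series l m)
    <= a m + series e (m + n)%N - series e m.
  elim: n => [|n IH]; first by rewrite addn0; lra.
  rewrite addnS !seriesS; have := rec (m + n)%N.
  have : limn a / 2 * l (m + n)%N <= l (m + n)%N * a (m + n)%N.
    by rewrite mulrC ler_wpM2l// ltW// am//= leq_addr.
  lra.
exfalso; apply: l_div.
(* This is [tail] solved for [series l (m + n)], with [a (m + n)] bounded below by [0] and
   [series e (m + n)] above by [E]. *)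
exists (series l m + (a m + E - series e m) / (limn a / 2)) => _ [n _ <-].
have l_mono : series l n <= series l (m + n)%N.
  have /nondecreasing_seqP : forall k, series l k <= series l k.+1.
    by move=> k; rewrite seriesS lerDl.
  by apply; exact: leq_addl.
rewrite (le_trans l_mono)// -lerBlDl ler_pdivlMr ?divr_gt0// mulrC.
have : series e (m + n)%N <= E by apply: Eub; exists (m + n)%N.
have := tail n; have := a_ge0 (m + n)%N; lra.
Qed.

(** Carries hypothesis (2) from the extended reals to the reals: each term is dominated by the
    finite total, so [fine] loses nothing. *)
Lemma nneseries_bounded_fine (R : realType) (F : (\bar R)^nat) (m : nat) :
  (forall n, (m <= n)%N -> 0 <= F n)%E ->
  (\sum_(m <= n <oo) F n < +oo)%E ->
  (forall n, (m <= n)%N -> F n \is a fin_num) /\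
  exists E, forall n, \sum_(m <= i < n) fine (F i) <= E.
Proof.
move=> F_ge0 F_lty.
have psum_le n : (\sum_(m <= i < n) F i <= \sum_(m <= i <oo) F i)%E.
  by apply: nneseries_lim_ge => i mi _; exact: F_ge0.
have F_fin n : (m <= n)%N -> F n \is a fin_num.
  move=> mn; rewrite ge0_fin_numE ?F_ge0//.
  apply: le_lt_trans F_lty; apply: le_trans (psum_le n.+1).
  rewrite big_nat_recr//= leeDr// big_nat_cond sume_ge0// => i /andP[/andP[mi _] _].
  exact: F_ge0.
split=> //; exists (fine (\sum_(m <= i <oo) F i)%E) => n.
have S_fin : (\sum_(m <= i <oo) F i)%E \is a fin_num.
  by rewrite ge0_fin_numE// nneseries_ge0// => i mi _; exact: F_ge0.
rewrite -lee_fin fineK// -sumEFin (le_trans _ (psum_le n))//.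
by rewrite [leLHS]big_nat [leRHS]big_nat lee_sum// => i /andP[mi _]; rewrite fineK// F_fin.
Qed.

Lemma limn_esup_lt_near (R : realType) (u : (\bar R)^nat) (r : \bar R) :
  (limn_esup u < r)%E -> exists2 s, (s < r)%E & \forall n \near \oo, (u n <= s)%E.
Proof.
move=> /ereal_inf_ltP[_ [V V_near <-] sup_lt].
exists (ereal_sup [set u n | n in V]) => //.
by apply: filterS V_near => n Vn; apply: ereal_sup_ubound; exists n.
Qed.

(** * Inner product identities and monotonicity estimates *)

Section InnerProduct.
Context (R : realType) (H : completeNormedModType R) (ip : {dot H for idfun}).
Implicit Types (x y z : H) (a : R).

Lemma dotC x y : ip x y = ip y x.
Proof. by rewrite hermC /= expr0 mul1r. Qed.

Lemma dotDr x y z : ip x (y + z) = ip x y + ip x z.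
Proof. exact: linearDr. Qed.

Lemma dotBl x y z : ip (x - y) z = ip x z - ip y z.
Proof. exact: linearBl. Qed.

Lemma dotBr x y z : ip x (y - z) = ip x y - ip x z.
Proof. exact: linearBr. Qed.

Lemma dotZr a x y : ip x (a *: y) = a * ip x y.
Proof. exact: linearZr_LR. Qed.

Lemma dot0r x : ip x 0 = 0.
Proof. exact: linear0r. Qed.

(** Meant for [w], [x], [p] equal to [x_(n+1)], [x_n], [p_n]: it isolates the pairing of [p_n - z]
    with the step, which monotonicity controls. *)
Lemma sqr_norm_four_points (ip_norm : inner_norm ip) (w x p z : H) :
  `|w - z| ^+ 2 =
  `|x - z| ^+ 2 - 2 * ip (p - z) (x - w) + `|w - p| ^+ 2 - `|x - p| ^+ 2.
Proof.
rewrite -!ip_norm !dotBl !dotBr (dotC z w) (dotC z x) (dotC p w) (dotC p x).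
ring.
Qed.

(** Normality of [q] at [z] says exactly that the supremum is attained at [z]. *)
Lemma support_fun_normal_cone (C : set H) z q r : 0 <= r ->
  normal_cone ip C z q -> support_fun ip C (r *: q) = (r * ip z q)%:E.
Proof.
move=> r_ge0 [Cz q_le0]; apply/eqP; rewrite eq_le; apply/andP; split.
  apply: ge_ereal_sup => _ [y Cy <-]; rewrite lee_fin dotZr ler_wpM2l//.
  by have := q_le0 _ Cy; rewrite dotBr subr_le0 !(dotC q).
by apply: ereal_sup_ubound; exists z; rewrite ?dotZr.
Qed.

(** Test the outer supremum at [z] and the Fitzpatrick supremum at the graph point [(y, B y)]. *)
Lemma fitzpatrick_gap_ge (B : H -> H) (C : set H) z q y r :
  0 <= r -> normal_cone ip C z q ->
  ((r * ip (y - z) q - ip (y - z) (B y))%:E <=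
   ereal_sup [set fitzpatrick ip (op_of_fun B) u (r *: q) | u in C]
   - support_fun ip C (r *: q))%E.
Proof.
move=> r_ge0 zq; rewrite (support_fun_normal_cone r_ge0 zq) leeBrDr//.
apply: (@le_trans _ _ (fitzpatrick ip (op_of_fun B) z (r *: q))); last first.
  by apply: ereal_sup_ubound; exists z => //; case: zq.
apply: ereal_sup_ubound; exists (y, B y) => //=; congr EFin.
rewrite dotZr !dotBl; ring.
Qed.

(** Compares [(p, a)] with [(z, v)] in [A] and [p] with [z] in [D], then trades [v + D z] for [- q].
    The [B] term is grouped with [q] so that [fitzpatrick_gap_ge] bounds it. *)
Lemma forward_backward_forward_ineq (gamma l b : R) (A : H -> set H) (D B : H -> H)
    (x w p z v q a : H) :
  op_strongly_monotone ip gamma A -> op_monotone ip (op_of_fun D) ->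
  0 < l -> 0 < b -> A z v -> v + D z + q = 0 -> A p a ->
  x - w = l *: (a + D p + b *: B p) ->
  l * gamma * `|p - z| ^+ 2 <=
  ip (p - z) (x - w) + l * b * (b^-1 * ip (p - z) q - ip (p - z) (B p)).
Proof.
move=> A_strong D_mono l_gt0 b_gt0 Azv vDq0 Apa ->.
have A_ge := A_strong p a z v Apa Azv.
have D_ge := D_mono p (D p) z (D z) erefl erefl.
have : ip (p - z) (v + D z + q) = 0 by rewrite vDq0 dot0r.
rewrite !dotZr !dotDr dotZr; move: A_ge D_ge; rewrite !(dotBr (p - z)).
set g := `|p - z| ^+ 2; move: (ip (p - z) a) (ip (p - z) v) => ia iv.
move: (ip _ (D p)) (ip _ (D z)) (ip _ q) (ip _ (B p)) => idp idz iq ib A_ge D_ge iq0.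
have -> : l * (ia + idp + b * ib) + l * b * (b^-1 * iq - ib) = l * (ia + idp + iq).
  by field; rewrite gt_eqF.
by rewrite -mulrA ler_pM2l//; lra.
Qed.

End InnerProduct.

(** * Convergence of the iterates *)

Theorem theorem21 (R : realType) (H : completeNormedModType R)
  (ip : {dot H for idfun}) (ip_norm : inner_norm ip)
  (A : H -> set H) (D B : H -> H) (C : set H)
  (eta mu gamma : R) (lambda beta : nat -> R) (x p : nat -> H)
  (A_max : op_maximally_monotone ip A)
  (eta_gt0 : 0 < eta)
  (D_mono : op_monotone ip (op_of_fun D))
  (D_lip : (eta^-1).-lipschitz D)
  (mu_gt0 : 0 < mu)
  (B_mono : op_monotone ip (op_of_fun B))
  (B_lip : (mu^-1).-lipschitz B)
  (C_def : C = op_zer (op_of_fun B))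
  (C_neq0 : C !=set0)
  (lambda_gt0 : forall n, (1 <= n)%N -> 0 < lambda n)
  (beta_gt0 : forall n, (1 <= n)%N -> 0 < beta n)
  (p_def : forall n, (1 <= n)%N ->
     resolvent (op_scale (lambda n) A)
       (x n - lambda n *: D (x n) - (lambda n * beta n) *: B (x n)) (p n))
  (x_def : forall n, (1 <= n)%N ->
     x n.+1 = (lambda n * beta n) *: (B (x n) - B (p n))
              + lambda n *: (D (x n) - D (p n)) + p n)
  (ANC_max : op_maximally_monotone ip (op_add A (normal_cone ip C)))
  (zer_neq0 :
     op_zer (op_add (op_add A (op_of_fun D)) (normal_cone ip C)) !=set0)
  (fitzpatrick_sum : forall q, op_ran (normal_cone ip C) q ->
     (\sum_(1 <= n <oo)
        (lambda n * beta n)%:E *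
        (ereal_sup [set fitzpatrick ip (op_of_fun B) u ((beta n)^-1 *: q)
                   | u in C]
         - support_fun ip C ((beta n)^-1 *: q)) < +oo)%E)
  (lambda_l2 : ell 2 lambda)
  (lambda_nl1 : ~ ell 1 lambda)
  (limsup_lt1 :
     (limn_esup (fun n => (lambda n * beta n / mu + lambda n / eta)%:E) < 1)%E)
  (gamma_gt0 : 0 < gamma)
  (A_strong : op_strongly_monotone ip gamma A) :
  exists z : H,
    op_zer (op_add (op_add A (op_of_fun D)) (normal_cone ip C)) = [set z] /\
    x @ \oo --> z.
Proof.
have cvg_zer z : op_zer (op_add (op_add A (op_of_fun D)) (normal_cone ip C)) z ->
    x @ \oo --> z.
  move=> [_ [v Azv [_ -> <-]] [q zq vDq0]].
  have Bz0 : B z = 0 by case: zq; rewrite C_def.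
  set gap := fun n => (ereal_sup [set fitzpatrick ip (op_of_fun B) u ((beta n)^-1 *: q)
    | u in C] - support_fun ip C ((beta n)^-1 *: q))%E.
  pose F n := ((lambda n * beta n)%:E * gap n)%E.
  have lb_ge0 n : (1 <= n)%N -> 0 <= lambda n * beta n.
    by move=> n1; rewrite ltW// mulr_gt0 ?lambda_gt0 ?beta_gt0.
  have bV_ge0 n : (1 <= n)%N -> 0 <= (beta n)^-1.
    by move=> n1; rewrite invr_ge0 ltW// beta_gt0.
  (* At [y = z] the lower bound of [fitzpatrick_gap_ge] is [0], since [B z = 0]. *)
  have gap_ge0 n : (1 <= n)%N -> (0 <= gap n)%E.
    move=> n1; have := fitzpatrick_gap_ge B z (bV_ge0 n n1) zq.
    by rewrite Bz0 subrr dot0r dotC dot0r mulr0 subrr.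
  have F_ge0 n : (1 <= n)%N -> (0 <= F n)%E.
    by move=> n1; rewrite mule_ge0 ?lee_fin ?lb_ge0 ?gap_ge0.
  have [F_fin [E E_ub]] := nneseries_bounded_fine F_ge0
    (fitzpatrick_sum q (ex_intro _ z zq)).
  have F_ub n : (1 <= n)%N ->
      lambda n * beta n * ((beta n)^-1 * ip (p n - z) q - ip (p n - z) (B (p n)))
      <= fine (F n).
    move=> n1; rewrite -lee_fin fineK ?F_fin// EFinM lee_wpmul2l ?lee_fin ?lb_ge0//.
    exact: (fitzpatrick_gap_ge B _ (bV_ge0 n n1) zq).
  have [k k_lt1 [N0 _ k_ub]] : exists2 k, k < 1 & \forall n \near \oo,
      lambda n * beta n / mu + lambda n / eta <= k.
    have [[k | |] k_lt1 k_ub] := limn_esup_lt_near limsup_lt1.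
    - by exists k => //; apply: filterS k_ub => n; rewrite lee_fin.
    - by rewrite ltNge leey in k_lt1.
    - by case: k_ub => N _ /(_ N) /= /(_ (leqnn N)); rewrite leeNy_eq.
  (* The successor keeps every index [n >= N] at least [1], where the recursion and the sign
     conditions hold. *)
  pose N := N0.+1.
  have k_gt0 : 0 < k.
    apply: lt_le_trans (k_ub N (leqnSn _)).
    by rewrite addr_gt0 ?divr_gt0 ?mulr_gt0 ?lambda_gt0 ?beta_gt0.
  have step n : (N <= n)%N -> `|x n.+1 - z| ^+ 2
      + 2 * gamma * lambda n * `|p n - z| ^+ 2 + (1 - k ^+ 2) * `|x n - p n| ^+ 2
      <= `|x n - z| ^+ 2 + 2 * fine (F n).
    move=> Nn; have n1 : (1 <= n)%N by apply: leq_trans Nn.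
    have [l_gt0 b_gt0] := (lambda_gt0 n n1, beta_gt0 n n1).
    have [_ -> [_ [a Apa <-] def_x]] := p_def n n1.
    have x_p : `|x n.+1 - p n| <= k * `|x n - p n|.
      have B_le : `|B (x n) - B (p n)| <= mu^-1 * `|x n - p n|.
        exact: (B_lip (x n, p n)).
      have D_le : `|D (x n) - D (p n)| <= eta^-1 * `|x n - p n|.
        exact: (D_lip (x n, p n)).
      rewrite x_def// addrK (le_trans (ler_normD _ _))// !normrZ.
      rewrite (gtr0_norm l_gt0) gtr0_norm ?mulr_gt0//.
      apply: (@le_trans _ _ ((lambda n * beta n / mu + lambda n / eta) * `|x n - p n|)).
        by rewrite mulrDl -!mulrA lerD// ?ler_pM2l// mulrA ler_pM2l ?mulr_gt0.
      by rewrite ler_wpM2r// k_ub//= ltnW.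
    (* The resolvent inclusion expresses [x n] through [p n] and [a]; the values of [B] and [D] at
       [x n] then cancel. *)
    have x_x : x n - x n.+1 = lambda n *: (a + D (p n) + beta n *: B (p n)).
      have xE : x n = p n + lambda n *: a + lambda n *: D (x n)
          + (lambda n * beta n) *: B (x n).
        by rewrite (addrAC _ (lambda n *: D (x n))) def_x !subrK.
      apply/eqP; rewrite subr_eq x_def//; apply/eqP; rewrite [LHS]xE.
      rewrite !scalerDr !scalerN scalerA !addrA.
      rewrite (addrAC _ (_ *: B (x n)) (- _)) addrK.
      rewrite (addrAC _ (_ *: D (x n)) (- _)) (addrAC _ (_ *: B (x n)) (- _)) addrK.
      by rewrite [RHS]addrC !addrA [LHS]addrAC.
    have := forward_backward_forward_ineq A_strong D_mono l_gt0 b_gt0 Azv vDq0 Apa x_x.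
    have := F_ub n n1.
    rewrite (sqr_norm_four_points ip_norm (x n.+1) (x n) (p n)).
    have : `|x n.+1 - p n| ^+ 2 <= k ^+ 2 * `|x n - p n| ^+ 2.
      by rewrite -exprMn lerXn2r// nnegrE ?mulr_ge0// ltW.
    lra.
  (* The first entry serves the [|p_n - z|^2] term; the second, with [lambda n <= eta], gives
     [2 c lambda_n <= 1 - k^2] for the [|x_n - p_n|^2] term. *)
  pose c := Num.min gamma ((1 - k ^+ 2) / (2 * eta)).
  have k2_lt1 : k ^+ 2 < 1 by rewrite expr_lt1// ltW.
  have c_gt0 : 0 < c by rewrite lt_min gamma_gt0 divr_gt0 ?subr_gt0 ?mulr_gt0.
  have decay n : (N <= n)%N -> `|x n.+1 - z| ^+ 2 + c * lambda n * `|x n - z| ^+ 2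
      <= `|x n - z| ^+ 2 + 2 * fine (F n).
    move=> Nn; have n1 : (1 <= n)%N by apply: leq_trans Nn.
    apply: le_trans (step n Nn); rewrite -addrA lerD2l.
    have l_lt : lambda n <= eta.
      have : lambda n / eta <= 1.
        apply: le_trans (ltW k_lt1); apply: le_trans (k_ub n (ltnW Nn)).
        by rewrite lerDr divr_ge0 ?lb_ge0// ltW.
      by rewrite ler_pdivrMr// mul1r.
    have c_gamma : c * lambda n <= gamma * lambda n.
      by rewrite ler_wpM2r ?(ltW (lambda_gt0 n n1))// ge_min lexx.
    have c_k : 2 * (c * lambda n) <= 1 - k ^+ 2.
      have : c * (2 * eta) <= 1 - k ^+ 2.
        by rewrite -ler_pdivlMr ?mulr_gt0// ge_min lexx orbT.
      have : c * lambda n <= c * eta by rewrite ler_pM2l.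
      lra.
    have cl_ge0 : 0 <= c * lambda n by rewrite ltW// mulr_gt0// lambda_gt0.
    have tri : `|x n - z| ^+ 2 <= 2 * `|p n - z| ^+ 2 + 2 * `|x n - p n| ^+ 2.
      have le_D : `|x n - z| <= `|p n - z| + `|x n - p n|.
        by rewrite [leRHS]addrC ler_distD.
      have : `|x n - z| ^+ 2 <= (`|p n - z| + `|x n - p n|) ^+ 2.
        by rewrite ler_pXn2r ?nnegrE ?addr_ge0.
      have := sqr_ge0 (`|p n - z| - `|x n - p n|).
      rewrite sqrrB sqrrD; lra.
    have := ler_wpM2l cl_ge0 tri.
    have := ler_wpM2r (sqr_ge0 `|p n - z|) c_gamma.
    have := ler_wpM2r (sqr_ge0 `|x n - p n|) c_k.
    lra.
  have l_div : ~ has_ubound (range (series (fun n => c * lambda (n + N)%N))).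
    move=> [M M_ub]; apply: lambda_nl1; rewrite /ell.
    (* The finitely many terms before [N] plus the assumed bound [M] on the shifted sums, with the
       factor [c] divided out. *)
    apply: (@le_lt_trans _ _ (\sum_(1 <= i < N) lambda i + c^-1 * M)%:E); last exact: ltry.
    apply: lime_le; first by apply: is_cvg_nneseries => n _ _; rewrite lee_fin.
    exists N => // n /= Nn.
    rewrite sumEFin lee_fin (eq_big_nat _ _ (F2 := lambda)); last first.
      by move=> i /andP[i1 _]; rewrite expr1 gtr0_norm// lambda_gt0.
    rewrite (@big_cat_nat _ _ _ N)//= lerD2l -{1}[N]add0n big_addn.
    by rewrite ler_pdivlMl// mulr_sumr; apply: M_ub; exists (n - N)%N.
  have e_bnd : has_ubound (range (series (fun n => 2 * fine (F (n + N)%N)))).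
    (* [E] bounds the sums started at [1]; the nonnegative terms before [N] are dropped. *)
    exists (2 * E) => _ [n _ <-].
    rewrite /series /= -mulr_sumr ler_pM2l//; apply: le_trans (E_ub (n + N)%N).
    rewrite [leRHS](@big_cat_nat _ _ _ N)/= ?leq_addl// [X in _ <= _ + X](big_addn 0 _ N).
    rewrite addnK lerDr big_nat sumr_ge0// => i /andP[i1 _].
    by rewrite fine_ge0// F_ge0.
  have sqr_cvg0 : `|x n - z| ^+ 2 @[n --> \oo] --> 0.
    rewrite -(cvg_shiftn N).
    apply: series_decay_cvg0 e_bnd l_div => n.
    - exact: sqr_ge0.
    - by rewrite mulr_ge0// fine_ge0// F_ge0 ?ltn_addl.
    - by rewrite mulr_ge0 ?ltW ?lambda_gt0 ?ltn_addl.
    - exact: (decay (n + N)%N (leq_addl n N)).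
  apply/cvgrPdist_lt => e e_gt0.
  apply: filterS (cvgr_lt _ sqr_cvg0 _ (exprn_gt0 2 e_gt0)) => n.
  by rewrite ltr_pXn2r ?nnegrE ?(ltW e_gt0)// distrC.
have [z zz] := zer_neq0.
exists z; split; last exact: (cvg_zer z zz).
apply/seteqP; split=> [y /cvg_zer y_lim | y ->//].
exact: (norm_cvg_unique y_lim (cvg_zer z zz)).
Qed.
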